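(* Let $X$ be a set, let $B(X)$ be the set of all real-valued bounded functions on $X$, let $(a_n)_{n\ge0}$ be real numbers with $a_n\ge 0$ for all $n\ge 0$ and $\sum_{n=0}^\infty a_n=1$, and let $(x_n)_{n\ge 0}$ be mutually distinct points of $X$. For $f\in B(X)$ put $f_n:=f(x_n)$ and $L(f):=\sum_{n=0}^\infty a_nf_n$. Then $L$ is a positive linear functional, and for all $f,g\in B(X)$, $$\left|L(fg)-L(f)\cdot L(g)\right|\le\frac12\left(1-\sum_{n=0}^\infty a_n^2\right)\cdot osc_L(f)\cdot osc_L(g),$$ where $osc_L(f):=\sup\{|f_n-f_m|:0\le n<m<\infty\}$ and $osc_L(g):=\sup\{|g_n-g_m|:0\le n<m<\infty\}$. *)

(* Defs.v *)
From HB Require Import structures.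
From mathcomp Require Import all_boot all_order all_algebra.
From mathcomp Require Import all_classical all_reals all_analysis.

Set Implicit Arguments.
Unset Strict Implicit.
Unset Printing Implicit Defensive.

Import Order.TTheory GRing.Theory Num.Theory.
Import numFieldNormedType.Exports.

Local Open Scope classical_set_scope.
Local Open Scope ring_scope.

(* B(X), as the subalgebra of bounded functions of the algebra X -> R with
   pointwise operations. *)
Section BoundedFunctions.
Variables (X : Type) (R : realType).

Definition bounded_pred : {pred X -> R} := mem (bounded_fun : set (X -> R)).

Record bfun := BFun { bfun_val :> X -> R ; bfunP : bfun_val \in bounded_pred }.

HB.instance Definition _ := [isSub for bfun_val].
HB.instance Definition _ := [Choice of bfun by <:].

Lemma bounded_predP (f : X -> R) :
  reflect (exists M, forall t, `|f t| <= M) (f \in bounded_pred).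
Proof.
apply: (iffP idP) => [/set_mem /pinfty_ex_gt0[M _ fM] | [M fM]].
  by exists M => t; apply: fM.
apply/mem_set; exists M; split; first exact: num_real.
by move=> N MN t _; apply: le_trans (fM t) (ltW MN).
Qed.

Lemma bounded_pred_subring : subring_closed bounded_pred.
Proof.
split=> [|f g /bounded_predP[M fM] /bounded_predP[N gN]
         |f g /bounded_predP[M fM] /bounded_predP[N gN]]; apply/bounded_predP.
- by exists 1 => t; rewrite normr1.
- exists (M + N) => t; apply: le_trans (ler_normB _ _) _.
  exact: lerD.
- by exists (M * N) => t; rewrite normrM ler_pM.
Qed.

HB.instance Definition _ :=
  GRing.isSubringClosed.Build _ bounded_pred bounded_pred_subring.

Lemma bounded_pred_scaler : GRing.scaler_closed bounded_pred.
Proof.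
move=> k f /bounded_predP[M fM]; apply/bounded_predP.
by exists (`|k| * M) => t; rewrite normrM ler_wpM2l.
Qed.

HB.instance Definition _ :=
  GRing.isScaleClosed.Build _ _ bounded_pred bounded_pred_scaler.

HB.instance Definition _ :=
  GRing.SubChoice_isSubComPzRing.Build (X -> R) bounded_pred bfun
    bounded_pred_subring.
HB.instance Definition _ := [SubZmodule_isSubLmodule of bfun by <:].

Definition positive_functional (L : bfun -> R) : Prop :=
  forall f : bfun, (forall t, 0 <= f t) -> 0 <= L f.

End BoundedFunctions.

Section DiscreteFunctional.
Variables (X : Type) (R : realType) (a : nat -> R) (x : nat -> X).

Definition discrete_functional (f : bfun X R) : R :=
  limn (series (fun n => a n * f (x n))).

Definition osc (f : bfun X R) : R :=
  sup [set `|f (x p.1) - f (x p.2)| | p in [set p : nat * nat | (p.1 < p.2)%N]].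

End DiscreteFunctional.

Lemma bfun_mulE (X : Type) (R : realType) (f g : bfun X R) t :
  (f * g) t = f t * g t.
Proof. by []. Qed.

Lemma bfun_linE (X : Type) (R : realType) (k : R) (f g : bfun X R) t :
  (k *: f + g) t = k * f t + g t.
Proof. by []. Qed.

(* Main.v *)
(** Writing [A], [P], [F], [G] for the [N]-th partial sums of [a], [a f g],
    [a f], [a g], the quantity [A P - F G] grows at step [N] by
    [a_N \sum_(i < N) a_i (f_i - f_N) (g_i - g_N)], while
    [A ^ 2 - \sum_(i < N) a_i ^ 2] grows by [2 a_N A].  Hence
    [|A P - F G| <= (A ^ 2 - \sum_(i < N) a_i ^ 2) / 2 * osc f * osc g] by
    induction, and the claim is the limit [N -> oo]. *)
Require Import Defs.
From HB Require Import structures.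
From mathcomp Require Import all_boot all_order all_algebra.
From mathcomp Require Import all_classical all_reals all_analysis.
From mathcomp Require Import ring.

Import Order.TTheory GRing.Theory Num.Theory.
Import numFieldNormedType.Exports.

Local Open Scope classical_set_scope.
Local Open Scope ring_scope.

(** Expanding the product gives four sums. With [c := u n] and [d := v n] these are the cross terms
    created when the [n]-th term is added. *)
Lemma gruss_sum_increment (R : comPzRingType) (a u v : nat -> R) (c d : R) (n : nat) :
  \sum_(0 <= i < n) a i * ((u i - c) * (v i - d)) =
  \sum_(0 <= i < n) a i * (u i * v i) + (\sum_(0 <= i < n) a i) * (c * d)
  - (\sum_(0 <= i < n) a i * u i) * d - (\sum_(0 <= i < n) a i * v i) * c.
Proof.
rewrite !mulr_suml -big_split -!sumrB; apply: eq_bigr => i _ /=; ring.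
Qed.

(** Partial sums of [a] need not equal 1, so the inequality is kept homogeneous of degree 2 in [a],
    which lets the induction go through. *)
Lemma gruss_partial_sum (R : realFieldType) (a u v : nat -> R) (M N : R) :
  (forall n, 0 <= a n) ->
  (forall i j, (i < j)%N -> `|u i - u j| <= M) ->
  (forall i j, (i < j)%N -> `|v i - v j| <= N) ->
  forall n,
  `|(\sum_(0 <= i < n) a i) * (\sum_(0 <= i < n) a i * (u i * v i))
    - (\sum_(0 <= i < n) a i * u i) * (\sum_(0 <= i < n) a i * v i)|
  <= 1 / 2 * ((\sum_(0 <= i < n) a i) ^+ 2 - \sum_(0 <= i < n) a i ^+ 2) * M * N.
Proof.
move=> a0 uM vN; elim=> [|n IHn].
  by rewrite !big_geq// !mulr0 expr0n !subrr normr0 mulr0 !mul0r.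
have := gruss_sum_increment R a u v (u n) (v n) n.
have : `|\sum_(0 <= i < n) a i * ((u i - u n) * (v i - v n))|
    <= (\sum_(0 <= i < n) a i) * (M * N).
  rewrite mulr_suml; apply: (le_trans (ler_norm_sum _ _ _)).
  apply: ler_sum_nat => i /andP[_ lt_in].
  by rewrite !normrM (ger0_norm (a0 i)) ler_wpM2l// ler_pM ?uM ?vN.
rewrite !big_nat_recr//=.
move: IHn.
set A := \sum_(0 <= i < n) a i; set P := \sum_(0 <= i < n) a i * (u i * v i).
set F := \sum_(0 <= i < n) a i * u i; set G := \sum_(0 <= i < n) a i * v i.
set Q := \sum_(0 <= i < n) a i ^+ 2; set S := \sum_(0 <= i < n) _ * (_ * _).
move=> IHn leS defS.
(* The two terms [a n ^+ 2 * u n * v n] cancel; what remains beyond [A * P - F * G] is [a n] times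
   the expansion of [S]. *)
have -> : (A + a n) * (P + a n * (u n * v n)) - (F + a n * u n) * (G + a n * v n)
    = (A * P - F * G) + a n * S by rewrite defS; ring.
have -> : 1 / 2 * ((A + a n) ^+ 2 - (Q + a n ^+ 2)) * M * N
    = 1 / 2 * (A ^+ 2 - Q) * M * N + a n * (A * (M * N)) by field.
apply: (le_trans (ler_normD _ _)); apply: lerD => //.
by rewrite normrM (ger0_norm (a0 n)) ler_wpM2l.
Qed.

(** Absolute convergence, by comparison with [M * a n]. *)
Lemma cvg_series_mul_bounded (R : realType) (a b : nat -> R) (M : R) :
  (forall n, 0 <= a n) -> cvgn (series a) -> (forall n, `|b n| <= M) ->
  cvgn (series (fun n => a n * b n)).
Proof.
move=> a0 cva bM; apply: normed_cvg.
apply: (@series_le_cvg _ _ (fun n => M * a n)) => [n|n|n|] /=.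
- exact: normr_ge0.
- by rewrite mulr_ge0// (le_trans _ (bM n)).
- by rewrite normrM (ger0_norm (a0 n)) mulrC ler_wpM2r.
- exact: (@is_cvg_seriesZ _ a M cva).
Qed.

(** The partial sum up to [n.+1] contains [a n], and nondecreasing partial sums stay below their
    limit. *)
Lemma term_le_sum (R : realType) (a : nat -> R) (l : R) :
  (forall n, 0 <= a n) -> series a n @[n --> \oo] --> l -> forall n, a n <= l.
Proof.
move=> a0 al n.
have nd : nondecreasing_seq (series a).
  apply/nondecreasing_seqP => k.
  by rewrite /series /= big_nat_recr//= lerDl.
rewrite -(cvg_lim _ al)//.
have := nondecreasing_cvgn_le nd (cvgP _ al) n.+1.
apply: le_trans; rewrite /series /= big_nat_recr//= lerDr.
by apply: sumr_ge0 => i _.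
Qed.

Lemma le_osc (X : Type) (R : realType) (x : nat -> X) (f : bfun X R) (i j : nat) :
  (i < j)%N -> `|f (x i) - f (x j)| <= osc x f.
Proof.
move=> ij; apply: ub_le_sup; last by exists (i, j).
(* Boundedness of [f] is what makes [sup] a genuine upper bound: the differences are at most
   [M + M]. *)
have /bounded_predP[M fM] := bfunP f.
exists (M + M) => _ [p _ <-].
by apply: (le_trans (ler_normB _ _)); apply: lerD.
Qed.

Theorem theorem2p4 (R : realType) (X : Type) (a : nat -> R) (x : nat -> X)
    (a_ge0 : forall n, 0 <= a n)
    (a_sum1 : series a n @[n --> \oo] --> (1 : R))
    (x_inj : injective x) :
  let L := discrete_functional a x in
  [/\ forall f : bfun X R, cvgn (series (fun n => a n * f (x n))),
      scalar L,
      positive_functional L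
    & forall f g : bfun X R,
        `|L (f * g) - L f * L g| <=
          1 / 2 * (1 - limn (series (fun n => a n ^+ 2)))
          * osc x f * osc x g].
Proof.
move=> L.
have cvL (f : bfun X R) : cvgn (series (fun n => a n * f (x n))).
  have /bounded_predP[M fM] := bfunP f.
  exact: (@cvg_series_mul_bounded _ _ _ M a_ge0 (cvgP _ a_sum1)).
have cvQ : cvgn (series (fun n => a n ^+ 2)).
  (* Here [a n ^+ 2] is read as [a n * a n], the second factor being at most the total mass 1. *)
  apply: (@cvg_series_mul_bounded _ _ _ 1 a_ge0 (cvgP _ a_sum1)) => n.
  by rewrite ger0_norm// (term_le_sum _ _ _ a_ge0 a_sum1).
split=> //.
- move=> k f g; apply: cvg_lim => //.
  have -> : series (fun n => a n * (k *: f + g) (x n)) =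
      (fun n => k * series (fun n => a n * f (x n)) n
                + series (fun n => a n * g (x n)) n).
    apply/funext => n; rewrite /series mulr_sumr -big_split.
    by apply: eq_bigr => i _; rewrite bfun_linE /=; ring.
  by apply: cvgD; [apply: cvgMr; exact: cvL | exact: cvL].
- move=> f f0; apply: limr_ge; first exact: cvL.
  by apply: nearW => n; apply: sumr_ge0 => i _; rewrite mulr_ge0.
- move=> f g.
  have bound := gruss_partial_sum _ _ _ _ _ _ a_ge0 (@le_osc _ _ x f) (@le_osc _ _ x g).
  (* The factor 1 stands for the limit of [series a], matching the factor [A] of the finite
     inequality. *)
  have -> : L (f * g) - L f * L g = 1 * L (f * g) - L f * L g by rewrite mul1r.
  have lhs : `|series a n * series (fun n => a n * (f * g) (x n)) n
      - series (fun n => a n * f (x n)) n * series (fun n => a n * g (x n)) n|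
      @[n --> \oo] --> `|1 * L (f * g) - L f * L g|.
    apply: cvg_norm; apply: cvgB; apply: cvgM => //; exact: cvL.
  have rhs : 1 / 2 * (series a n ^+ 2 - series (fun n => a n ^+ 2) n)
      * osc x f * osc x g @[n --> \oo] -->
      1 / 2 * (1 ^+ 2 - limn (series (fun n => a n ^+ 2))) * osc x f * osc x g.
    do 2 apply: cvgMl; apply: cvgMr; apply: cvgB => //.
    by apply: cvgM.
  rewrite expr1n in rhs.
  rewrite -(cvg_lim _ lhs)// -(cvg_lim _ rhs)//.
  apply: ler_lim; [exact: cvgP lhs | exact: cvgP rhs | exact: nearW].
Qed.
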